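(* Let $n,m\ge1$ and $q,\alpha,\beta\in\mathbb N$ with $\gcd(\alpha,\beta)=1$, let $p=\gcd(m,n)$, and let $C(n,q\alpha)\in\{a<z\}^n$ and $C(m,q\beta)\in\{b<z\}^m$ be two superimposable Christoffel words. Let $r$ be an integer with $qr\equiv1\pmod p$. Then for every integer $i$ with $0\le i<\frac mp$, the words $C(n,q\alpha)$ and $\gamma^{-(r-1)+ip}\,\widetilde C(m,q\beta)$ are perfectly superimposable.
   Context: $\mathbb N=\{0,1,2,\dots\}$. For coprime $s,t\in\mathbb N$ and $n=s+t$, the Christoffel word over the ordered alphabet $\{a<z\}$ with $s$ occurrences of $a$ and $t$ occurrences of $z$ is $u=u[0]u[1]\cdots u[n-1]$ with $u[i]=a$ if $((i+1)t \bmod n)>(it\bmod n)$ and $u[i]=z$ otherwise. It is denoted $C(n,s)$; calling $C(n,s)$ a Christoffel word presupposes $\gcd(n,s)=1$. Over $\{b<z\}$ the definition is the same with $b$ in place of $a$. $\widetilde C(n,s)$ denotes the reversal (mirror image) of $C(n,s)$. For a letter $c$ and a finite word $w$, $\gamma(cw)=wc$; $\gamma$ is a bijection on words of a given length, and $\gamma^k$ is defined for all $k\in\mathbb Z$. Let $u\in\{a,z\}^n$ and $v\in\{b,z\}^m$, let $A$ be the set of positions (indexed from $0$) of the letter $a$ in $u$ and $B$ the set of positions of the letter $b$ in $v$. The words $u,v$ are perfectly superimposable if $(A+n\mathbb Z)\cap(B+m\mathbb Z)=\emptyset$, and superimposable if there is $k\in\mathbb Z$ with $(A+n\mathbb Z)\cap(B-k+m\mathbb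 Z)=\emptyset$ (equivalently, $u$ and $\gamma^k(v)$ are perfectly superimposable for some $k$). *)

(* Defs.v *)
From mathcomp Require Import all_boot all_order all_algebra.
From mathcomp Require Import classical_sets.

Set Implicit Arguments.
Unset Strict Implicit.
Unset Printing Implicit Defensive.

Import GRing.Theory.
Local Open Scope ring_scope.
Local Open Scope classical_set_scope.

(* The alphabets {a < z} and {b < z} are both taken inside one type.
   The order on letters is only a convention: it says which letter is written
   when the residue increases, namely the smaller one. *)
Variant letter := La | Lb | Lz.

Definition word := seq letter.

(* C(n, s) over {c < z}, with t = n - s.  It is meant to be used under
   [is_christoffel_pair n s]; in particular the subtraction is then exact.
   The formula is kept verbatim for n = 1 too, where every residue is 0 and
   both C(1, 0) and C(1, 1) are the word z. *)
Definition christoffel (c : letter) (n s : nat) : word :=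
  let t := (n - s)%N in
  mkseq (fun i => if (i.+1 * t %% n > i * t %% n)%N then c else Lz) n.

Definition is_christoffel_pair (n s : nat) : Prop :=
  (s <= n)%N /\ coprime n s.

(* gamma (c w) = w c is [rot 1], whose inverse is [rotr 1]. *)
Definition gamma_pow (k : int) (w : word) : word :=
  match k with
  | Posz j => iter j (rot 1) w
  | Negz j => iter j.+1 (rotr 1) w
  end.

Definition positions (c : letter) (w : word) : set int :=
  [set x | exists i : nat, [/\ (i < size w)%N, nth Lz w i = c & x = i%:Z]].

(* X + l Z *)
Definition periodize (l : nat) (X : set int) : set int :=
  [set y | exists x k : int, X x /\ y = x + k * l%:Z].

(* X - k *)
Definition shift_left (k : int) (X : set int) : set int :=
  [set y | exists x : int, X x /\ y = x - k].

Definition perfectly_superimposable (u v : word) : Prop :=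
  periodize (size u) (positions La u) `&` periodize (size v) (positions Lb v)
    = set0.

Definition superimposable (u v : word) : Prop :=
  exists k : int,
    periodize (size u) (positions La u)
      `&` periodize (size v) (shift_left k (positions Lb v)) = set0.

(* Main.v *)
(** Write [a], [b] for alpha, beta and [p = gcd(m, n)].  The positions of the
    small letter in C(n, s) are the residues [x] with [- x s mod n] in [0, s),
    and by the Chinese remainder theorem disjointness of two periodic sets of
    periods [n] and [m] may be tested modulo [p].  After multiplication by the
    unit [q a b], superimposability says that the set
    [S = {a j' + b j : 0 <= j < q a, 0 <= j' < q b}] misses a class modulo [p],
    and the conclusion says that it misses the class of [(2q - 1) a b].
    Missing some class forces [p = (2q - 2) a b + a e + b f] with [e, f >= 1].
    With this form of [p], an element of [S] congruent to [(2q - 1) a b] yields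
    [a b = a X + b Y] with [X, Y >= 1], impossible for coprime [a], [b]. *)

Require Import Defs.
From mathcomp Require Import all_boot all_order all_algebra.
From mathcomp Require Import classical_sets.
From mathcomp Require Import zify ring.

Set Implicit Arguments.
Unset Strict Implicit.
Unset Printing Implicit Defensive.

Import Order.TTheory GRing.Theory Num.Theory.
Local Open Scope ring_scope.

(** * Arithmetic of the sums a j' + b j for coprime a, b *)

Lemma coprime_mul_neq_pos (a b X Y : int) :
  coprimez a b -> 0 < a -> 0 < b -> 0 < X -> 0 < Y -> a * b <> a * X + b * Y.
Proof.
move=> cab a0 b0 X0 Y0 e.
(* Reducing modulo b gives b | X, so a X alone is already at least a b. *)
have : (b %| X)%Z.
  rewrite -(@Gauss_dvdzr b a X) 1?coprimez_sym //.
  by apply/dvdzP; exists (a - Y); nia.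
case/dvdzP=> c Ec; subst X.
have c0 : 0 < c by nia.
have : 0 <= (c - 1) * (a * b) by nia.
nia.
Qed.

Lemma bezout_coord (a b N : int) : coprimez a b -> 0 < a ->
  exists c d : int, [/\ N = a * c + b * d, 0 <= d & d < a].
Proof.
move=> cab a0; have [u [v E]] := Bezoutz a b.
rewrite (eqP cab) in E.
exists (N * u + b * ((N * v) %/ a)%Z), ((N * v) %% a)%Z; split.
- have := divz_eq (N * v) a; move: (_ %/ _)%Z (_ %% _)%Z => c d h.
  rewrite -[LHS]mulr1 -E; transitivity (a * (N * u) + b * (N * v)); first by ring.
  by rewrite h; ring.
- by apply: modz_ge0; lia.
- by have := ltz_mod (N * v) (_ : a != 0); lia.
Qed.

Definition in_sumset (q a b N : int) : Prop :=
  exists j j' : int, [/\ 0 <= j < q * a, 0 <= j' < q * b & N = a * j' + b * j].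

(** Replacing (c, d) by (c - b t, d + a t) keeps the sum; t = min(c div b, q - 1) brings both
    coefficients into range. *)
Lemma in_sumset_coord (q a b c d : int) : 0 < q -> 0 < a -> 0 < b ->
  0 <= d < a -> 0 <= c < (2 * q - 1) * b -> in_sumset q a b (a * c + b * d).
Proof.
move=> q0 a0 b0 /andP[d0 da] /andP[c0 cb].
have h := divz_eq c b.
have r0 : 0 <= (c %% b)%Z by apply: modz_ge0; lia.
have rb : (c %% b)%Z < b by have := ltz_mod c (_ : b != 0); lia.
move: (c %/ b)%Z (c %% b)%Z h r0 rb => t e h r0 rb.
have t0 : 0 <= t by nia.
case: (lerP t (q - 1)) => tq.
  by exists (d + a * t), (c - b * t); split;
    [apply/andP; split; nia | apply/andP; split; nia | ring].
by exists (d + a * (q - 1)), (c - b * (q - 1)); split;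
  [apply/andP; split; nia | apply/andP; split; nia | ring].
Qed.

(* Take consecutive members [x < (2q - 1) a b <= x + p] of the missed class and
   write both as [a c + b d] with [0 <= d < a]; since neither is in the sumset,
   [c] is negative for [x] and at least [(2q - 1) b] for [x + p]. *)
Lemma modulus_decomposition (q a b p x0 : int) :
  coprimez a b -> 0 < q -> 0 < a -> 0 < b -> 0 < p ->
  (forall l, ~ in_sumset q a b (x0 + l * p)) ->
  exists e f : int, [/\ 0 < e, 0 < f & p = (2 * q - 2) * (a * b) + a * e + b * f].
Proof.
move=> cab q0 a0 b0 p0 miss.
pose M := (2 * q - 1) * (a * b).
have [x [l [Ex Ex' xM Mx]]] : exists x l : int,
    [/\ x = x0 + l * p, x + p = x0 + (l + 1) * p, x < M & M <= x + p].
  have h := divz_eq (x0 - M) p.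
  have r0 : 0 <= ((x0 - M) %% p)%Z by apply: modz_ge0; lia.
  have rp : ((x0 - M) %% p)%Z < p by have := ltz_mod (x0 - M) (_ : p != 0); lia.
  (* This is the representative of the class of x0 in [M - p, M). *)
  exists (((x0 - M) %% p)%Z + M - p), (- ((x0 - M) %/ p)%Z - 1).
  move: (_ %/ _)%Z (_ %% _)%Z h r0 rp => t e h r0 rp.
  by split; [have -> : x0 = (x0 - M) + M by ring | have -> : x0 = (x0 - M) + M by ring | lia | lia];
    rewrite h; ring.
have [c [d [Ec d0 da]]] := bezout_coord x cab a0.
have [c' [d' [Ec' d0' da']]] := bezout_coord (x + p) cab a0.
have cneg : c < 0.
  case: (ltrP c 0) => // c0; case: (miss l); rewrite -Ex Ec.
  apply: in_sumset_coord => //; first by rewrite d0.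
  rewrite c0 /=; rewrite /M in xM; nia.
have cbig : (2 * q - 1) * b <= c'.
  case: (lerP ((2 * q - 1) * b) c') => // cb; case: (miss (l + 1)); rewrite -Ex' Ec'.
  apply: in_sumset_coord => //; first by rewrite d0'.
  rewrite cb andbT; rewrite /M in Mx.
  have : a * b <= (2 * q - 1) * (a * b) by nia.
  nia.
(* Subtract the two representations. As d' - d > -a, lending one a b to the b-part makes f positive
   and turns 2q - 1 into 2q - 2. *)
exists (c' - c - (2 * q - 1) * b), (a + d' - d); split; [lia | lia |].
by lia.
Qed.

Lemma notin_sumset_mod (q a b p x0 : int) :
  coprimez a b -> 0 < q -> 0 < a -> 0 < b -> 0 < p ->
  (forall l, ~ in_sumset q a b (x0 + l * p)) ->
  forall k, ~ in_sumset q a b ((2 * q - 1) * (a * b) + k * p).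
Proof.
move=> cab q0 a0 b0 p0 miss k [j [j' [/andP[j0 jq] /andP[j0' jq'] E]]].
have [e [f [e0 f0 Ep]]] := modulus_decomposition cab q0 a0 b0 p0 miss.
case: (lerP 0 k) => k0.
  (* Write a b = 2 q a b - (a j' + b j) + k p; the upper bounds on j and j' make both coefficients
     positive. *)
  apply: (@coprime_mul_neq_pos a b (q * b - j' + k * e + k * (2 * q - 2) * b)
    (q * a - j + k * f) cab a0 b0); [|nia|].
    have : 0 <= k * e by nia.
    have : 0 <= k * (2 * q - 2) * b by nia.
    lia.
  rewrite Ep in E.
  by lia.
(* For k = -(h + 1), one of the h + 1 copies of (2q - 2) a b is absorbed by (2q - 1) a b, leaving a
   b. *)
have [h [h0 hk]] : exists h : int, h >= 0 /\ k = - (h + 1) by exists (- k - 1); lia.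
apply: (@coprime_mul_neq_pos a b (j' + (h + 1) * e + h * (2 * q - 2) * b)
    (j + (h + 1) * f) cab a0 b0).
    have : 0 <= h * e by nia.
    have : 0 <= h * (2 * q - 2) * b by nia.
    lia.
  by nia.
rewrite Ep hk in E.
by lia.
Qed.

(** * Words as periodic functions on the integers *)

Definition cyclic_nth (w : word) (y : int) : letter :=
  nth Lz w `|(y %% (size w)%:Z)%Z|%N.

Lemma periodizeP (c : letter) (w : word) (y : int) : (0 < size w)%N ->
  periodize (size w) (positions c w) y <-> cyclic_nth w y = c.
Proof.
move=> w0; rewrite /cyclic_nth; split.
  move=> [x [k [[i [iw ic ->]] ->]]].
  by rewrite addrC modzMDl modz_small ?ltz_nat.
move=> yc; exists (y %% (size w)%:Z)%Z, (y %/ (size w)%:Z)%Z; split; last first.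
  by rewrite addrC -divz_eq.
have r0 : 0 <= (y %% (size w)%:Z)%Z by apply: modz_ge0; lia.
have rw : (y %% (size w)%:Z)%Z < (size w)%:Z by apply: ltz_pmod; lia.
by exists `|(y %% (size w)%:Z)%Z|%N; split=> //; lia.
Qed.

Lemma periodize_shift (l : nat) (k : int) (X : set int) (y : int) :
  periodize l (shift_left k X) y <-> periodize l X (y + k).
Proof.
split.
  move=> [_ [j [[x [Xx ->]] ->]]]; exists x, j; split=> //; ring.
move=> [x [j [Xx E]]]; exists (x - k), j; split; first by exists x.
by rewrite addrAC -E addrK.
Qed.

Lemma cyclic_nth_rot1 (w : word) (y : int) :
  cyclic_nth (rot 1 w) y = cyclic_nth w (y + 1).
Proof.
rewrite /cyclic_nth size_rot; case: w => [|x s]; first by rewrite /rot /= !nth_nil.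
rewrite rot1_cons nth_rcons /= -modzDml.
have r0 : 0 <= (y %% (size s).+1%:Z)%Z by apply: modz_ge0.
have rw : (y %% (size s).+1%:Z)%Z < (size s).+1%:Z by apply: ltz_pmod.
case: (y %% _)%Z r0 rw => // k _ kw /=.
case: (ltngtP k (size s)) => [ks|ks|->]; last by rewrite -PoszD addn1 modzz.
  by rewrite -PoszD modz_small ?addn1.
by move: kw; rewrite ltz_nat ltnS leqNgt ks.
Qed.

Lemma cyclic_nth_gamma (k : int) (w : word) (y : int) :
  cyclic_nth (gamma_pow k w) y = cyclic_nth w (y + k).
Proof.
have rotr1 (v : word) x : cyclic_nth (rotr 1 v) x = cyclic_nth v (x - 1).
  by rewrite -{2}(rotrK 1 v) cyclic_nth_rot1 subrK.
case: k => k; rewrite /gamma_pow; last rewrite NegzE; elim: k y => [|k IH] y.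
- by rewrite addr0.
- by rewrite iterS cyclic_nth_rot1 IH -addrA -intS.
- by rewrite /= rotr1.
- by rewrite iterS rotr1 IH; congr cyclic_nth; lia.
Qed.

Lemma size_gamma (k : int) (w : word) : size (gamma_pow k w) = size w.
Proof.
by case: k => k /=; [|rewrite size_rotr]; elim: k => //= k IH; rewrite ?size_rot ?size_rotr.
Qed.

Lemma cyclic_nth_rev (w : word) (y : int) : (0 < size w)%N ->
  cyclic_nth (rev w) y = cyclic_nth w (- 1 - y).
Proof.
move=> w0; rewrite /cyclic_nth size_rev.
have h := divz_eq y (size w).
have r0 : 0 <= (y %% size w)%Z by apply: modz_ge0; lia.
have rw : (y %% size w)%Z < size w by apply: ltz_pmod; lia.
move: (y %/ _)%Z (y %% _)%Z h r0 rw => k [] // i -> _ iw.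
rewrite nth_rev ?ltz_nat //=.
(* Reversal sends i to [size w] - 1 - i, that is, to -1 - i modulo the length. *)
have -> : - 1 - (k * size w + i) = (- k - 1) * size w + (size w - i.+1)%N :> int.
  by rewrite -subzn //; lia.
by rewrite modzMDl modz_small ?absz_nat // ltz_nat; lia.
Qed.

(** * Letters of a Christoffel word through residues *)

Lemma christoffel_letterP (n s i : nat) : (0 < n)%N ->
  (i * (n - s) %% n < i.+1 * (n - s) %% n)%N = (s < n)%N && (i * (n - s) %% n < s)%N.
Proof.
move=> n0; rewrite mulSn -modnDmr.
have : (i * (n - s) %% n < n)%N by rewrite ltn_mod.
move: (_ %% n)%N => x xn.
case: (ltnP s n) => sn /=; last first.
  have E : (n - s = 0)%N by lia.
  by rewrite E add0n modn_small // ltnn.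
have [->|s0] := posnP s; first by rewrite subn0 modnDl modn_small // ltnn ltn0.
(* The sum x + (n - s) stays below n exactly when x < s; otherwise it wraps down to x - s. *)
case: (ltnP x s) => xs; first by rewrite modn_small; lia.
have -> : (n - s + x = n + (x - s))%N by lia.
by rewrite modnDl modn_small; lia.
Qed.

(** Since n - s is -s modulo n, the residue compared with s is the j in [0, n) with n | y s + j. *)
Lemma cyclic_nth_christoffel (c : letter) (n s : nat) (y : int) :
  c <> Lz -> (0 < n)%N ->
  cyclic_nth (christoffel c n s) y = c <->
  (s < n)%N /\ exists2 j : int, 0 <= j < s%:Z & (n%:Z %| y * s%:Z + j)%Z.
Proof.
move=> cz n0; rewrite /cyclic_nth /christoffel size_mkseq.
have h := divz_eq y n.
have r0 : 0 <= (y %% n)%Z by apply: modz_ge0; lia.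
have rw : (y %% n)%Z < n by apply: ltz_pmod; lia.
move: (y %/ _)%Z (y %% _)%Z h r0 rw => k [] // i -> _ iw.
rewrite nth_mkseq //= christoffel_letterP //.
have hx := divn_eq (i * (n - s)) n.
have : (i * (n - s) %% n < n)%N by rewrite ltn_mod.
move: (_ %/ n)%N (_ %% n)%N hx => d x hx xn; split.
  case: ifP => [/andP[sn xs] _|_ /esym //]; split=> //.
  have hz : i%:Z * (n%:Z - s%:Z) = d%:Z * n%:Z + x%:Z.
    by rewrite subzn ?(ltnW sn) // -!PoszM -PoszD hx.
  exists x%:Z; first by lia.
  by apply/dvdzP; exists (k * s%:Z + i%:Z - d%:Z); lia.
case=> sn [j /andP[j0 js] /dvdzP[e E]]; rewrite sn /=.
have hz : i%:Z * (n%:Z - s%:Z) = d%:Z * n%:Z + x%:Z.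
  by rewrite subzn ?(ltnW sn) // -!PoszM -PoszD hx.
suff -> : (x < s)%N by [].
suff : x%:Z = j by lia.
have {}E : x%:Z - j = (k * s%:Z + i%:Z - d%:Z - e) * n%:Z by lia.
have Z0 : k * s%:Z + i%:Z - d%:Z - e = 0.
  move: (_ - e) E => f E.
  by case: (ltrgtP f 0) => // f0; nia.
by rewrite Z0 mul0r in E; lia.
Qed.

(** * From disjoint periodic sets to a missed class modulo p *)

Lemma chinese_noncoprime (n m a b : int) : (gcdz n m %| a - b)%Z ->
  exists y : int, (n %| y - a)%Z /\ (m %| y - b)%Z.
Proof.
move=> /dvdzP[c E]; have [u [v B]] := Bezoutz n m.
exists (a - c * u * n); split; apply/dvdzP; first by exists (- (c * u)); ring.
exists (c * v); rewrite addrAC E -B; ring.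
Qed.

Lemma inverse_mod (a n : int) : coprimez a n -> exists b : int, (n %| a * b - 1)%Z.
Proof.
move=> cab; have [u [v E]] := Bezoutz a n; rewrite (eqP cab) in E.
by exists u; apply/dvdzP; exists (- v); lia.
Qed.

(** An element of the sumset in this class would provide, by the Chinese remainder theorem, a common
    position x. The offset alpha (q beta - 1) comes from reflecting the range of j'. *)
Lemma disjoint_christoffel_misses_class (n m q alpha beta : nat) (k : int) :
  (0 < n)%N -> (0 < m)%N -> (q * alpha < n)%N -> (q * beta < m)%N ->
  coprime n (q * alpha) -> coprime m (q * beta) ->
  (forall x, cyclic_nth (christoffel La n (q * alpha)) x = La ->
     cyclic_nth (christoffel Lb m (q * beta)) (x + k) <> Lb) ->
  forall l, ~ in_sumset q alpha beta
    (k * (q * alpha * beta)%N%:Z + alpha%:Z * (q%:Z * beta%:Z - 1)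
     + l * (gcdn m n)%:Z).
Proof.
move=> hn hm sn sm cu cv hk l; set p := (gcdn m n)%:Z.
have pn : (p %| n%:Z)%Z by rewrite dvdzE /= dvdn_gcdr.
have pm : (p %| m%:Z)%Z by rewrite dvdzE /= dvdn_gcdl.
move=> [h [h' [hb hb' E]]].
have cA : coprimez (q * alpha)%N%:Z n%:Z by rewrite /coprimez /= coprime_sym in cu *.
have cB : coprimez (q * beta)%N%:Z m%:Z by rewrite /coprimez /= coprime_sym in cv *.
have [si Si] := inverse_mod cA; have [ta Ta] := inverse_mod cB.
(* Disjointness controls the differences [b j - a j'], the sumset has sums:
   reflecting the range of [j'] passes from one to the other. *)
pose h2 := (q * beta)%N%:Z - 1 - h'.
have cp : coprimez p ((q * alpha)%N%:Z * (q * beta)%N%:Z).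
  rewrite coprimezMr; apply/andP; split.
    by rewrite coprimez_sym; apply: coprimez_dvdr pn cA.
  by rewrite coprimez_sym; apply: coprimez_dvdr pm cB.
have [x [xn xm]] : exists x, (n%:Z %| x - - (si * h))%Z /\ (m%:Z %| x - (- (ta * h2) - k))%Z.
  apply: chinese_noncoprime.
  have -> : gcdz n m = p by rewrite /gcdz /= gcdnC.
  rewrite -(Gauss_dvdzr _ cp).
  have /dvdzP[e1 E1] := dvdz_trans pn Si.
  have /dvdzP[e2 E2] := dvdz_trans pm Ta.
  (* After multiplication by q alpha q beta, [si] and [ta] disappear modulo p, and what remains is
     -q times the relation [E], hence the term q l. *)
  apply/dvdzP; exists (- (q * beta)%N%:Z * h * e1 + (q * alpha)%N%:Z * h2 * e2 - q%:Z * l).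
  transitivity (- (q * beta)%N%:Z * h * ((q * alpha)%N%:Z * si - 1) +
    (q * alpha)%N%:Z * h2 * ((q * beta)%N%:Z * ta - 1) -
    q%:Z * (alpha%:Z * h' + beta%:Z * h -
    (k * (q * alpha * beta)%N%:Z + alpha%:Z * (q%:Z * beta%:Z - 1)))).
    by rewrite /h2 !PoszM; ring.
  by rewrite E1 E2 -E; ring.
have [e1 E1] := dvdzP xn; have [e2 E2] := dvdzP xm.
have [e3 E3] := dvdzP Si; have [e4 E4] := dvdzP Ta.
apply: (hk x).
  apply/(cyclic_nth_christoffel _ _ _ hn) => //; split=> //.
  exists h => //; apply/dvdzP; exists ((q * alpha)%N%:Z * e1 - h * e3).
  transitivity ((q * alpha)%N%:Z * (x - - (si * h)) -
    h * ((q * alpha)%N%:Z * si - 1)); first by ring.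
  by rewrite E1 E3; ring.
apply/(cyclic_nth_christoffel _ _ _ hm) => //; split=> //.
exists h2; first by rewrite /h2; lia.
apply/dvdzP; exists ((q * beta)%N%:Z * e2 - h2 * e4).
transitivity ((q * beta)%N%:Z * (x - (- (ta * h2) - k)) -
  h2 * ((q * beta)%N%:Z * ta - 1)); first by ring.
by rewrite E2 E4; ring.
Qed.

Theorem theorem4p4 (n m q alpha beta : nat) (r : int)
  (hn : (1 <= n)%N) (hm : (1 <= m)%N)
  (hab : coprime alpha beta)
  (hu : is_christoffel_pair n (q * alpha))
  (hv : is_christoffel_pair m (q * beta))
  (hsup : superimposable (christoffel La n (q * alpha))
                         (christoffel Lb m (q * beta)))
  (hr : (q%:Z * r = 1 %[mod (gcdn m n)%:Z])%Z) :
  forall i : int, 0 <= i -> i < (m %/ gcdn m n)%N%:Z ->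
    perfectly_superimposable
      (christoffel La n (q * alpha))
      (gamma_pow (- (r - 1) + i * (gcdn m n)%:Z)
                 (rev (christoffel Lb m (q * beta)))).
Proof.
move=> i _ _; set u := christoffel La _ _ in hsup *; set v := christoffel Lb _ _ in hsup *.
have su : size u = n by rewrite size_mkseq.
have sv : size v = m by rewrite size_mkseq.
rewrite /perfectly_superimposable -subset0 => y [].
move/periodizeP; rewrite su => /(_ hn) /(cyclic_nth_christoffel _ _ _ hn) [//|sn [j jb jn]].
move/periodizeP; rewrite size_gamma size_rev sv => /(_ hm).
rewrite cyclic_nth_gamma cyclic_nth_rev ?sv // => /(cyclic_nth_christoffel _ _ _ hm) [//|sm [j' jb' jm]].
(* The intervals [0, q alpha) and [0, q beta) contain j and j', so they are nonempty. *)
have [q0 a0 b0] : [/\ 0 < q%:Z, 0 < alpha%:Z & 0 < beta%:Z].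
  by move: jb jb'; case: (q) (alpha) (beta) => [|q'] [|a] [|b] //=; lia.
have p0 : 0 < (gcdn m n)%:Z by rewrite ltz_nat gcdn_gt0 hm.
set p := (gcdn m n)%:Z in hr p0 jm *.
have pn : (p %| n%:Z)%Z by rewrite dvdzE /= dvdn_gcdr.
have pm : (p %| m%:Z)%Z by rewrite dvdzE /= dvdn_gcdl.
have cab : coprimez alpha%:Z beta%:Z by [].
have Mq : (p %| q%:Z * r - 1)%Z by rewrite -eqz_mod_dvd hr.
case: hsup => k hk.
have hdisj x : cyclic_nth u x = La -> cyclic_nth v (x + k) <> Lb.
  move=> xu xv; have : set0 x; last by [].
  rewrite -hk; split; first by apply/periodizeP; rewrite ?su.
  by apply/periodize_shift/periodizeP; rewrite ?sv.
have miss := disjoint_christoffel_misses_class hn hm sn sm hu.2 hv.2 hdisj.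
have /dvdzP[e1 E1] := dvdz_trans pn jn.
have /dvdzP[e2 E2] := dvdz_trans pm jm.
have /dvdzP[e3 E3] := Mq.
(* Add beta times the congruence for j to alpha times that for j': reversal negates y, so y cancels,
   leaving (2q - q r) alpha beta, which is (2q - 1) alpha beta modulo p as q r is 1. *)
apply: (notin_sumset_mod cab q0 a0 b0 p0 miss
  (k := alpha%:Z * e2 + beta%:Z * e1 - alpha%:Z * beta%:Z * e3 + alpha%:Z * beta%:Z * q%:Z * i)).
exists j, j'; split=> //.
transitivity (alpha%:Z * (e2 * p) + beta%:Z * (e1 * p) + 2 * q%:Z * alpha%:Z * beta%:Z
  - alpha%:Z * beta%:Z * (q%:Z * r - 1 + 1) + alpha%:Z * beta%:Z * q%:Z * i * p).
  by rewrite E3; ring.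
by rewrite -E1 -E2 !PoszM; ring.
Qed.
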